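(* Let $n\ge 1$ be a natural number (even or odd), let $\lambda\in\mathbb{R}$, and let $x,s\in\mathbb{R}^{n+1}$ be such that $x\notin[s]$. Define $$k_L(s,x):=(s-\bar x)\,(s^2-2x_0s+|x|^2)^{-\lambda},\qquad k_R(s,x):=(s^2-2x_0s+|x|^2)^{-\lambda}\,(s-\bar x)$$ for all such $x,s$ satisfying $s^2-2x_0s+|x|^2\in\mathbb{R}^{n+1}\setminus(-\infty,0]$. Then the function $k_L(s,x)$ is left monogenic in the variable $x$, and the function $k_R(s,x)$ is right monogenic in the variable $x$, if and only if $\lambda=\frac{n+1}{2}$. (That is: $k_L$ is left monogenic in $x$ if and only if $\lambda=\frac{n+1}{2}$, and $k_R$ is right monogenic in $x$ if and only if $\lambda=\frac{n+1}{2}$.)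
   Context: $\mathbb{R}_n$ denotes the real Clifford algebra over $n$ imaginary units $e_1,\dots,e_n$ with $e_\ell e_m+e_me_\ell=0$ for $\ell\neq m$ and $e_\ell^2=-1$. A point $(x_0,x_1,\dots,x_n)\in\mathbb{R}^{n+1}$ is identified with the paravector $x=x_0+\underline{x}\in\mathbb{R}_n$, where $\underline{x}=\sum_{\ell=1}^n x_\ell e_\ell$; its conjugate is $\bar x=x_0-\underline{x}$ and $|x|^2=x_0^2+x_1^2+\dots+x_n^2$. Let $\mathbb{S}=\{\underline{x}=\sum_{\ell=1}^n x_\ell e_\ell : x_1^2+\dots+x_n^2=1\}$, so $I^2=-1$ for $I\in\mathbb{S}$. For $s=s_0+\underline{s}\in\mathbb{R}^{n+1}$ set $[s]=\{s_0+I|\underline{s}| : I\in\mathbb{S}\}$. If $s=u+Iv$ with $u,v\in\mathbb{R}$, $I\in\mathbb{S}$, then $s^2-2x_0s+|x|^2$ lies in $\mathbb{R}+I\mathbb{R}$ and is hence a paravector. Fractional powers: for a paravector $y=u+I_yv\in\mathbb{R}^{n+1}\setminus(-\infty,0]$ with $I_y=\underline{y}/|\underline{y}|$ and $v=|\underline{y}|$ (if $\underline{y}=0$ then $v=0$ and $I_y\in\mathbb{S}$ is arbitrary), and $\alpha\in\mathbb{R}$, one sets $y^\alpha:=e^{\alpha\log y}=e^{\alpha(\ln|y|+I_y\arg(y))}$, where $\arg(y)=\arccos\frac{u}{|y|}$. Monogenic functions: a real differentiable function $f:U\to\mathbb{R}_n$ on an open set $U\subseteq\mathbb{R}^{n+1}$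 is left monogenic if $\partial_{x_0}f(x)+\sum_{i=1}^n e_i\,\partial_{x_i}f(x)=0$ on $U$, and right monogenic if $\partial_{x_0}f(x)+\sum_{i=1}^n \partial_{x_i}f(x)\,e_i=0$ on $U$. Monogenicity in $x$ refers, for fixed $s$, to the open set of all $x\notin[s]$ with $s^2-2x_0s+|x|^2\notin(-\infty,0]$. *)

(* Defs.v *)
From HB Require Import structures.
From mathcomp Require Import all_boot all_order all_algebra.
From mathcomp Require Import all_classical all_reals all_analysis.

Set Implicit Arguments.
Unset Strict Implicit.
Unset Printing Implicit Defensive.

Import Order.TTheory GRing.Theory Num.Theory.
Import numFieldNormedType.Exports.

Local Open Scope classical_set_scope.
Local Open Scope ring_scope.

Section BasisSign.
Context {n : nat}.
Implicit Types (A B C : {set 'I_n}) (i j : 'I_n).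

Definition symdiff A B : {set 'I_n} := ((A :\: B) :|: (B :\: A))%SET.

(* The number of pairs (i, j) in A x B with j < i counts the transpositions
   that sort the word e_A e_B, and the pairs with i = j the relations
   e_i ^ 2 = -1 used afterwards: e_A * e_B = (-1) ^ blade_inv A B e_(A (+) B). *)
Definition blade_inv A B : nat :=
  #|[set p : 'I_n * 'I_n | [&& p.1 \in A, p.2 \in B & (p.2 <= p.1)%N]]%SET|.

Lemma in_symdiff A B i : (i \in symdiff A B) = (i \in A) (+) (i \in B).
Proof. by rewrite !inE; case: (i \in A); case: (i \in B). Qed.

Lemma symdiffC A B : symdiff A B = symdiff B A.
Proof. by apply/setP => i; rewrite !in_symdiff addbC. Qed.

Lemma symdiffA A B C : symdiff A (symdiff B C) = symdiff (symdiff A B) C.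
Proof. by apply/setP => i; rewrite !in_symdiff addbA. Qed.

Lemma symdiffK A B : symdiff A (symdiff A B) = B.
Proof. by apply/setP => i; rewrite !in_symdiff addKb. Qed.

Lemma symdiff0 A : symdiff A finset.set0 = A.
Proof. by apply/setP => i; rewrite in_symdiff inE addbF. Qed.

Lemma symdiff_id A : symdiff A A = finset.set0.
Proof. by apply/setP => i; rewrite in_symdiff inE addbb. Qed.

Lemma odd_blade_inv A B : odd (blade_inv A B) =
  \big[addb/false]_(p : 'I_n * 'I_n) [&& p.1 \in A, p.2 \in B & (p.2 <= p.1)%N].
Proof.
rewrite /blade_inv cardsE -sum1_card big_mkcond /=.
rewrite (big_morph odd oddD (erefl : odd 0 = false)).
by apply: eq_bigr => p _; rewrite unfold_in /=; case: [&& _, _ & _].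
Qed.

Lemma odd_blade_invDl A B C :
  odd (blade_inv (symdiff A B) C) = odd (blade_inv A C) (+) odd (blade_inv B C).
Proof.
rewrite !odd_blade_inv -big_split; apply: eq_bigr => p _ /=.
by rewrite in_symdiff; do 3!case: (_ \in _); case: (_ <= _)%N.
Qed.

Lemma odd_blade_invDr A B C :
  odd (blade_inv A (symdiff B C)) = odd (blade_inv A B) (+) odd (blade_inv A C).
Proof.
rewrite !odd_blade_inv -big_split; apply: eq_bigr => p _ /=.
by rewrite in_symdiff; do 3!case: (_ \in _); case: (_ <= _)%N.
Qed.

Lemma blade_inv0l A : blade_inv finset.set0 A = 0%N.
Proof. by apply/eqP; rewrite cards_eq0; apply/eqP/setP => p; rewrite !inE. Qed.

Lemma blade_inv0r A : blade_inv A finset.set0 = 0%N.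
Proof.
by apply/eqP; rewrite cards_eq0; apply/eqP/setP => p; rewrite !inE andbF.
Qed.

End BasisSign.

(* The carrier of R_n, with the product topology and the sup norm of R^(2^n);
   the coordinates are indexed by the subsets of the set of generators. *)
Definition clifford (R : realType) (n : nat) := 'rV[R]_#|{set 'I_n}|.

HB.instance Definition _ (R : realType) (n : nat) :=
  NormedModule.copy (clifford R n) 'rV[R]_#|{set 'I_n}|.

Section Algebra.
Context {R : realType} {n : nat}.
Implicit Types (x y z : clifford R n) (A B C : {set 'I_n}).

Definition ccoef x A : R := x ord0 (enum_rank A).

Definition of_coef (f : {set 'I_n} -> R) : clifford R n :=
  \row_i f (enum_val i).

Definition blade A : clifford R n := of_coef (fun B => (B == A)%:R).

Definition cliff_mul x y : clifford R n :=
  of_coef (fun C => \sum_(A : {set 'I_n})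
    (-1) ^+ blade_inv A (symdiff A C) * ccoef x A * ccoef y (symdiff A C)).

Lemma ccoefE f A : ccoef (of_coef f) A = f A.
Proof. by rewrite /ccoef mxE enum_rankK. Qed.

Lemma ccoefP x y : (forall A, ccoef x A = ccoef y A) -> x = y.
Proof.
by move=> xy; apply/rowP => i; have := xy (enum_val i); rewrite /ccoef enum_valK.
Qed.

Lemma ccoefD x y A : ccoef (x + y) A = ccoef x A + ccoef y A.
Proof. by rewrite /ccoef mxE. Qed.

Lemma ccoefZ a x A : ccoef (a *: x) A = a * ccoef x A.
Proof. by rewrite /ccoef mxE. Qed.

Lemma cliff_mulA : associative cliff_mul.
Proof.
move=> x y z; apply: ccoefP => D; rewrite !ccoefE.
under eq_bigr => A _ do rewrite ccoefE mulr_sumr.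
under [RHS]eq_bigr => A _ do rewrite ccoefE mulr_sumr mulr_suml.
rewrite [RHS]exchange_big /=; apply: eq_bigr => A _.
rewrite [RHS](reindex_inj (can_inj (symdiffK A))) /=; apply: eq_bigr => B _.
rewrite symdiffK -symdiffA !mulrA.
have -> : symdiff A (symdiff B D) = symdiff B (symdiff A D).
  by rewrite !symdiffA (symdiffC A).
congr (_ * _ * _); rewrite mulrAC; congr (_ * _).
set E := symdiff B (symdiff A D).
have -> : symdiff A D = symdiff B E by rewrite symdiffK.
rewrite -!exprD -[LHS]signr_odd -[RHS]signr_odd !oddD.
rewrite odd_blade_invDr odd_blade_invDl.
by congr (_ ^+ _); do 3!case: (odd _).
Qed.

Lemma cliff_mul1r : left_id (blade finset.set0) cliff_mul.
Proof.
move=> x; apply: ccoefP => C; rewrite ccoefE (bigD1 finset.set0)//= big1.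
  by rewrite ccoefE eqxx blade_inv0l (symdiffC finset.set0) symdiff0 !mul1r addr0.
by move=> A /negPf A0; rewrite ccoefE A0 mulr0 mul0r.
Qed.

Lemma cliff_mulr1 : right_id (blade finset.set0) cliff_mul.
Proof.
move=> x; apply: ccoefP => C; rewrite ccoefE (bigD1 C)//= big1.
  by rewrite ccoefE symdiff_id eqxx blade_inv0r mul1r mulr1 addr0.
move=> A AC; rewrite ccoefE; case: eqP => [AC0|_]; last by rewrite mulr0.
by case/eqP: AC; rewrite -[C](symdiffK A) AC0 symdiff0.
Qed.

Lemma cliff_mulDl : left_distributive cliff_mul +%R.
Proof.
move=> x y z; apply: ccoefP => C; rewrite ccoefD !ccoefE -big_split.
by apply: eq_bigr => A _; rewrite ccoefD mulrDr mulrDl.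
Qed.

Lemma cliff_mulDr : right_distributive cliff_mul +%R.
Proof.
move=> x y z; apply: ccoefP => C; rewrite ccoefD !ccoefE -big_split.
by apply: eq_bigr => A _; rewrite ccoefD mulrDr.
Qed.

Lemma blade0_neq0 : blade finset.set0 != 0.
Proof.
apply/eqP => /(congr1 (fun x => ccoef x finset.set0)).
by rewrite ccoefE eqxx /ccoef mxE => /eqP; rewrite oner_eq0.
Qed.

HB.instance Definition _ := GRing.Zmodule_isNzRing.Build (clifford R n)
  cliff_mulA cliff_mul1r cliff_mulr1 cliff_mulDl cliff_mulDr blade0_neq0.

Lemma cliff_scalerAl (a : R) x y : a *: (x * y) = (a *: x) * y.
Proof.
apply: ccoefP => C; rewrite ccoefZ !ccoefE mulr_sumr.
by apply: eq_bigr => A _; rewrite ccoefZ [in RHS]mulrCA !mulrA.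
Qed.

Lemma cliff_scalerAr (a : R) x y : a *: (x * y) = x * (a *: y).
Proof.
apply: ccoefP => C; rewrite ccoefZ !ccoefE mulr_sumr.
by apply: eq_bigr => A _; rewrite ccoefZ mulrCA.
Qed.

HB.instance Definition _ :=
  GRing.Lmodule_isLalgebra.Build R (clifford R n) cliff_scalerAl.
HB.instance Definition _ :=
  GRing.Lalgebra_isAlgebra.Build R (clifford R n) cliff_scalerAr.

Definition gen (i : 'I_n) : clifford R n := blade [set i]%SET.

Lemma blade_mul A B :
  blade A * blade B = (-1) ^+ blade_inv A B *: blade (symdiff A B).
Proof.
apply: ccoefP => C; rewrite ccoefZ !ccoefE (bigD1 A)//= big1 ?addr0.
  rewrite !ccoefE eqxx mulr1.
  have -> : (symdiff A C == B) = (C == symdiff A B).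
    by apply/eqP/eqP => [<-|->]; rewrite symdiffK.
  by case: eqP => [->|_]; rewrite ?symdiffK// !mulr0.
by move=> D /negPf DA; rewrite ccoefE DA mulr0 mul0r.
Qed.

Lemma blade_inv1 (i j : 'I_n) :
  blade_inv [set i]%SET [set j]%SET = (j <= i)%N.
Proof.
rewrite /blade_inv; have [ji|ij] := leqP j i.
  rewrite -[RHS](cards1 (i, j)); apply: eq_card => -[k l] /=.
  by rewrite !inE -pair_eqE /=; do 2!case: eqP => // ->.
by apply: eq_card0 => -[k l] /=; rewrite !inE; do 2!case: eqP => // ->;
   rewrite leqNgt ij.
Qed.

Lemma gen_sqr i : gen i * gen i = -1.
Proof. by rewrite blade_mul blade_inv1 leqnn symdiff_id scaleN1r. Qed.

Lemma gen_anticomm i j : i != j -> gen i * gen j + gen j * gen i = 0.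
Proof.
move=> ij; rewrite !blade_mul !blade_inv1 (symdiffC [set j]%SET) -scalerDl.
have : i != j :> nat by [].
by rewrite neq_ltn; case: ltngtP => //= _ _; rewrite ?subrr ?addNr scale0r.
Qed.

End Algebra.

Arguments gen {R n} i.

Section Paravectors.
Context {R : realType} {n : nat}.

(* x_0 is x 0 ord0 and the coordinate along gen i is x 0 (lift ord0 i). *)
Definition para (x : 'rV[R]_n.+1) : clifford R n :=
  (x ord0 ord0)%:A + \sum_(i < n) x ord0 (lift ord0 i) *: gen i.

Definition paravector : set (clifford R n) := range para.

(* On a paravector q = q_0 + q_: q_0, q_, the conjugate of q, |q_| and |q|. *)
Definition sc (q : clifford R n) : R := ccoef q finset.set0.
Definition vec (q : clifford R n) : clifford R n :=
  \sum_(i < n) ccoef q [set i]%SET *: gen i.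
Definition pconj (q : clifford R n) : clifford R n := (sc q)%:A - vec q.
Definition vnorm (q : clifford R n) : R :=
  Num.sqrt (\sum_(i < n) ccoef q [set i]%SET ^+ 2).
Definition pnorm (q : clifford R n) : R :=
  Num.sqrt (sc q ^+ 2 + \sum_(i < n) ccoef q [set i]%SET ^+ 2).

Definition sphere_units : set (clifford R n) :=
  [set q | exists2 v : 'rV[R]_n, \sum_(i < n) v ord0 i ^+ 2 = 1 &
           q = \sum_(i < n) v ord0 i *: gen i].

Definition sphere_of (s : 'rV[R]_n.+1) : set 'rV[R]_n.+1 :=
  [set x | exists2 I, sphere_units I &
           para x = (sc (para s))%:A + vnorm (para s) *: I].

Definition nonpos_axis : set (clifford R n) :=
  [set q | exists2 a : R, a <= 0 & q = a%:A].

Definition cliff_exp (q : clifford R n) : clifford R n :=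
  limn (series (fun k => k`!%:R^-1 *: q ^+ k)).

(* The unit I_y is y_ / |y_|, which is 0 when y_ = 0: outside nonpos_axis the
   argument then vanishes, so that the choice of I_y does not matter. *)
Definition unit_im (y : clifford R n) : clifford R n := (vnorm y)^-1 *: vec y.

Definition arg (y : clifford R n) : R := acos (sc y / pnorm y).

Definition cliff_log (y : clifford R n) : clifford R n :=
  (ln (pnorm y))%:A + arg y *: unit_im y.

Definition cliff_pow (y : clifford R n) (alpha : R) : clifford R n :=
  cliff_exp (alpha *: cliff_log y).

End Paravectors.

Section Monogenic.
Context {R : realType} {n : nat}.
Implicit Types (U : set 'rV[R]_n.+1) (f : 'rV[R]_n.+1 -> clifford R n).

Definition partial (i : 'I_n.+1) f (x : 'rV[R]_n.+1) : clifford R n :=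
  'D_(delta_mx ord0 i) f x.

Definition left_monogenic U f :=
  open U /\ forall x, U x -> differentiable f x /\
    partial ord0 f x + \sum_(i < n) gen i * partial (lift ord0 i) f x = 0.

Definition right_monogenic U f :=
  open U /\ forall x, U x -> differentiable f x /\
    partial ord0 f x + \sum_(i < n) partial (lift ord0 i) f x * gen i = 0.

End Monogenic.

Section Kernels.
Context {R : realType} {n : nat}.
Implicit Types (s x : 'rV[R]_n.+1).

Definition kernel_base s x : clifford R n :=
  para s ^+ 2 - (2 * sc (para x)) *: para s + (pnorm (para x) ^+ 2)%:A.

Definition kernel_dom s : set 'rV[R]_n.+1 :=
  [set x | ~ sphere_of s x /\
           (paravector `\` nonpos_axis) (kernel_base s x)].

(* Only the values of the kernels for x in kernel_dom s are meaningful. *)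
Definition kL (lambda : R) s x : clifford R n :=
  (para s - pconj (para x)) * cliff_pow (kernel_base s x) (- lambda).

Definition kR (lambda : R) s x : clifford R n :=
  cliff_pow (kernel_base s x) (- lambda) * (para s - pconj (para x)).

End Kernels.

(* Main.v *)
From HB Require Import structures.
Require Import Defs.
From mathcomp Require Import all_boot all_order all_algebra.
From mathcomp Require Import all_classical all_reals all_analysis.
From mathcomp Require Import ring lra.

Set Implicit Arguments.
Unset Strict Implicit.
Unset Printing Implicit Defensive.

Import Order.TTheory GRing.Theory Num.Theory.
Import numFieldNormedType.Exports.

Local Open Scope classical_set_scope.
Local Open Scope ring_scope.

(** Fix s = u + v I. For every x the base P = s ^ 2 - 2 x_0 s + |x| ^ 2 lies in
    the complex line R + I R, which does not depend on x and whose elements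
    commute with s and with each other. There P ^ alpha is the ordinary power of
    a complex number on the slit plane, so that it obeys the usual rule
    d P ^ alpha = alpha dP P ^ -1 P ^ alpha ([is_diff_cliff_pow]). This rests on
    exp (c + d I) = exp c (cos d + I sin d) ([cliff_exp_cplx]) and on a smooth
    formula for the argument ([acos_cabs]).

    Write N = s - conj x and D for the Cauchy-Riemann operator, which is
    d/dx_0 + sum_i e_i d/dx_i. By the Leibniz rule, D (N P ^ - lambda) is the
    sum of (D N) P ^ - lambda = - (n + 1) P ^ - lambda and
      - 2 lambda (N (x_0 - s) + x_ N) P ^ -1 P ^ - lambda,
    because dP/dx_0 = 2 (x_0 - s) and dP/dx_i = 2 x_i. Expanding the
    parenthesis, without commuting x and s, gives - P. Therefore
      D (N P ^ - lambda) = (2 lambda - (n + 1)) P ^ - lambda   ([dirac_kL]),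
    and likewise on the right ([dirac_kR]). A power of P never vanishes and the
    domain is nonempty ([kernel_dom_neq0]), so this is identically zero exactly
    when lambda = (n + 1) / 2. *)

(** * Vectors, paravectors and their coordinates *)

Section Vectors.
Context {R : realType} {n : nat}.
Implicit Types (w z : 'I_n -> R) (x s : 'rV[R]_n.+1) (q : clifford R n).

Definition vpart w : clifford R n := \sum_(i < n) w i *: gen i.

Definition xvec x i : R := x ord0 (lift ord0 i).

Lemma paraE x : para x = (x ord0 ord0)%:A + vpart (xvec x).
Proof. by []. Qed.

Lemma vpartZ a w : vpart (fun i => a * w i) = a *: vpart w.
Proof.
by rewrite /vpart scaler_sumr; apply: eq_bigr => i _; rewrite scalerA.
Qed.

(** The generators anticommute, so only the squares e_i ^ 2 = -1 survive in the
    product. *)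
Lemma vpart_sqr w : vpart w * vpart w = - (\sum_(i < n) w i ^+ 2)%:A.
Proof.
have E : vpart w * vpart w =
    \sum_i \sum_j (w i * w j) *: (gen i * gen j : clifford R n).
  rewrite /vpart mulr_suml; apply: eq_bigr => i _.
  rewrite mulr_sumr; apply: eq_bigr => j _.
  by rewrite -scalerAl -scalerAr scalerA.
(* symmetrising the double sum leaves only the diagonal terms *)
have E2 : (vpart w * vpart w) *+ 2 = - (\sum_(i < n) w i ^+ 2)%:A *+ 2.
  rewrite mulr2n {1}E [X in _ + X]E [X in _ + X]exchange_big -big_split /=.
  rewrite scaler_suml -sumrN -sumrMnl; apply: eq_bigr => i _.
  rewrite -big_split /= (bigD1 i)//= big1 => [|j ji].
    by rewrite addr0 gen_sqr -mulr2n expr2 scalerN.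
  by rewrite (mulrC (w j)) -scalerDr gen_anticomm 1?eq_sym// scaler0.
apply: (@scalerI _ _ (2 : R)); first by rewrite pnatr_eq0.
by rewrite !scaler_nat.
Qed.

Lemma ccoef_sum (I : finType) (f : I -> clifford R n) A :
  ccoef (\sum_i f i) A = \sum_i ccoef (f i) A.
Proof. by rewrite /ccoef summxE. Qed.

Lemma ccoefN q A : ccoef (- q) A = - ccoef q A.
Proof. by rewrite /ccoef mxE. Qed.

Lemma ccoef_alg (a : R) A :
  ccoef (a%:A : clifford R n) A = a * (A == finset.set0)%:R.
Proof. by rewrite ccoefZ ccoefE. Qed.

Lemma ccoef_vpart0 w : ccoef (vpart w) finset.set0 = 0.
Proof.
rewrite ccoef_sum big1// => i _; rewrite ccoefZ ccoefE.
by rewrite eq_sym -cards_eq0 cards1 mulr0.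
Qed.

Lemma ccoef_vpart1 w i : ccoef (vpart w) [set i]%SET = w i.
Proof.
rewrite ccoef_sum (bigD1 i)//= big1 => [|j ji].
  by rewrite ccoefZ ccoefE eqxx mulr1 addr0.
rewrite ccoefZ ccoefE (_ : _ == _ = false) ?mulr0//.
by apply: contraNF ji => /eqP/set1_inj->.
Qed.

Lemma sc_vpart a w : sc (a%:A + vpart w) = a.
Proof. by rewrite /sc ccoefD ccoef_alg ccoef_vpart0 eqxx mulr1 addr0. Qed.

Lemma ccoef1_vpart a w i : ccoef (a%:A + vpart w) [set i]%SET = w i.
Proof.
by rewrite ccoefD ccoef_alg ccoef_vpart1 -cards_eq0 cards1 mulr0 add0r.
Qed.

Lemma vec_vpart a w : vec (a%:A + vpart w) = vpart w.
Proof. by apply: eq_bigr => i _; rewrite ccoef1_vpart. Qed.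

Lemma pconj_vpart a w : pconj (a%:A + vpart w) = a%:A - vpart w.
Proof. by rewrite /pconj sc_vpart vec_vpart. Qed.

Lemma vnorm_vpart a w :
  vnorm (a%:A + vpart w) = Num.sqrt (\sum_(i < n) w i ^+ 2).
Proof.
by congr Num.sqrt; apply: eq_bigr => i _; rewrite ccoef1_vpart.
Qed.

Lemma pnorm_vpart a w :
  pnorm (a%:A + vpart w) = Num.sqrt (a ^+ 2 + \sum_(i < n) w i ^+ 2).
Proof.
congr (Num.sqrt (_ + _)); first by rewrite sc_vpart.
by apply: eq_bigr => i _; rewrite ccoef1_vpart.
Qed.

Lemma pnorm_vpart_sqr a w :
  pnorm (a%:A + vpart w) ^+ 2 = a ^+ 2 + \sum_(i < n) w i ^+ 2.
Proof.
rewrite pnorm_vpart sqr_sqrtr// addr_ge0 ?sqr_ge0//.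
by apply: sumr_ge0 => i _; rewrite sqr_ge0.
Qed.

Lemma paravector_vpart a w : paravector (a%:A + vpart w).
Proof.
exists (\row_j oapp w a (unlift ord0 j)) => //.
rewrite paraE mxE unlift_none /=; congr (_ + _).
by apply: eq_bigr => i _; rewrite /xvec mxE liftK.
Qed.

End Vectors.

(** * The complex line spanned by an imaginary unit *)

Section ComplexLine.
Context {R : realType} {n : nat}.
Variable w : 'I_n -> R.
Hypothesis w1 : \sum_(i < n) w i ^+ 2 = 1.

(** The point p + q I of the complex line through the unit vector I of
    coordinates w, written with the scaled vector q w so that the lemmas on
    scalar and vector parts apply to it by conversion. *)
Definition cplx (p q : R) : clifford R n := p%:A + vpart (fun i => q * w i).

Lemma cplxE p q : cplx p q = p%:A + q *: vpart w.
Proof. by rewrite /cplx vpartZ. Qed.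

Lemma vpart_unit_sqr : vpart w * vpart w = -1.
Proof. by rewrite vpart_sqr w1 scale1r. Qed.

Lemma cplxD p q p' q' : cplx p q + cplx p' q' = cplx (p + p') (q + q').
Proof. by rewrite !cplxE addrACA -!scalerDl. Qed.

Lemma cplxZ a p q : a *: cplx p q = cplx (a * p) (a * q).
Proof. by rewrite !cplxE scalerDr !scalerA. Qed.

Lemma cplxN p q : - cplx p q = cplx (- p) (- q).
Proof. by rewrite -scaleN1r cplxZ !mulN1r. Qed.

Lemma cplx_alg p : p%:A = cplx p 0.
Proof. by rewrite cplxE scale0r addr0. Qed.

Lemma cplxM p q p' q' :
  cplx p q * cplx p' q' = cplx (p * p' - q * q') (p * q' + q * p').
Proof.
rewrite !cplxE mulrDl !mulrDr -!scalerAl !mul1r -!scalerAr !mulr1.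
rewrite vpart_unit_sqr !scalerA scalerN scalerBl scalerDl.
by rewrite [X in _ + X]addrC addrACA.
Qed.

Lemma cplxMC p q p' q' : cplx p q * cplx p' q' = cplx p' q' * cplx p q.
Proof. by rewrite !cplxM; congr cplx; ring. Qed.

(** A unit vector has a nonzero coordinate, along which q can be read. *)
Lemma cplx_inj p q p' q' : cplx p q = cplx p' q' -> p = p' /\ q = q'.
Proof.
move=> E; split; first by have := congr1 sc E; rewrite !sc_vpart.
have [|/existsP[i wi]] := boolP ([forall i, w i == 0]).
  move=> /forallP w0; have := w1; rewrite big1 => [/esym/eqP|i _].
    by rewrite oner_eq0.
  by rewrite (eqP (w0 i)) expr0n.
have := congr1 (fun z => ccoef z [set i]%SET) E.
by rewrite !ccoef1_vpart => /(mulIf wi).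
Qed.

Lemma sum_sqr_cplx q : \sum_(i < n) (q * w i) ^+ 2 = q ^+ 2.
Proof.
under eq_bigr do rewrite exprMn.
by rewrite -mulr_sumr w1 mulr1.
Qed.

End ComplexLine.

(** * Exponential generating functions *)

Section Egf.
Context {R : realType}.
Implicit Types (u v : nat -> R) (t M : R).

Definition egf u t : R := limn (pseries (fun k => u k / k`!%:R) t).

(** Coefficients of at most geometric growth are dominated by those of a real
    exponential series. *)
Lemma is_cvg_egf u C M t : (forall k, `|u k| <= C * M ^+ k) ->
  cvgn (pseries (fun k => u k / k`!%:R) t).
Proof.
move=> uM.
have uM' k : `|u k| <= `|C| * `|M| ^+ k.
  by rewrite -normrX -normrM (le_trans (uM k))// ler_norm.
apply: normed_cvg; rewrite /normed_series_of.
have h0 k : 0 <= `|C| * exp_coeff (`|M| * `|t|) k.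
  by rewrite mulr_ge0// /exp_coeff /= divr_ge0// exprn_ge0// mulr_ge0.
apply: (series_le_cvg (v_ := fun k => `|C| * exp_coeff (`|M| * `|t|) k)) => //.
  by move=> k /=.
  move=> k /=; rewrite !normrM normrX normfV (@ger0_norm _ k`!%:R)//.
  have -> : `|C| * exp_coeff (`|M| * `|t|) k
      = `|C| * `|M| ^+ k / k`!%:R * `|t| ^+ k.
    by rewrite /exp_coeff /= exprMn; ring.
  by rewrite ler_wpM2r ?exprn_ge0// ler_wpM2r ?invr_ge0.
exact: is_cvg_seriesZ (is_cvg_series_exp_coeff _).
Qed.

Lemma egf0 u : egf u 0 = u 0%N.
Proof.
apply: cvg_lim => //; rewrite -cvg_shiftS.
apply: cvg_near_cst; apply: nearW => k.
rewrite /pseries /series /= big_nat_recl//= fact0 divr1 expr0 mulr1.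
rewrite big1 ?addr0//.
by move=> i _; rewrite exprS mul0r mulr0.
Qed.

(** Differentiating an exponential generating function shifts its
    coefficients. *)
Lemma is_derive_egf u C M t : (forall k, `|u k| <= C * M ^+ k) ->
  is_derive t 1 (egf u) (egf (fun k => u k.+1) t).
Proof.
move=> uM.
have diffsE v :
    pseries_diffs (fun k => v k / k`!%:R) = (fun k => v k.+1 / k`!%:R).
  apply/funext => i; rewrite /pseries_diffs factS natrM invfM.
  by rewrite mulrCA mulVKf.
have K1 : `|t| < `| `|t| + 1 | by rewrite [ltRHS]ger0_norm ?ltrDl// addr_ge0.
have := @pseries_snd_diffs _ (fun k => u k / k`!%:R) (`|t| + 1) t _ _ _ K1.
rewrite !diffsE; apply; first exact: (@is_cvg_egf _ C M).
  by apply: (@is_cvg_egf _ (C * M) M) => k; rewrite -mulrA -exprS.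
by apply: (@is_cvg_egf _ (C * M * M) M) => k; rewrite -!mulrA -!exprS.
Qed.

Lemma egf_lin u v c d C M t :
    (forall k, `|u k| <= C * M ^+ k) -> (forall k, `|v k| <= C * M ^+ k) ->
  egf (fun k => c * u k + d * v k) t = c * egf u t + d * egf v t.
Proof.
move=> uM vM; apply: cvg_lim => //.
rewrite /egf; set a := limn _; set b := limn _.
have -> : pseries (fun k => (c * u k + d * v k) / k`!%:R) t =
    (fun k => c * pseries (fun k => u k / k`!%:R) t k
            + d * pseries (fun k => v k / k`!%:R) t k).
  apply/funext => k; rewrite /pseries /series /= !mulr_sumr -big_split /=.
  by apply: eq_bigr => i _; ring.
apply: cvgD; apply: cvgMr; exact: (is_cvg_egf _ (C := C) (M := M)).
Qed.

Lemma is_derive_mulc (F : R -> R) (t d df : R) :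
  is_derive (d * t) 1 F df -> is_derive t 1 (F \o *%R d) (d * df).
Proof.
move=> Fd; have dd : is_derive t 1 ( *%R d) d.
  by apply: is_derive_eq (is_deriveZ d (is_derive_id t 1)) _; rewrite scaler1.
by apply: is_derive_eq (is_derive1_comp Fd dd) _; rewrite mulrC.
Qed.

End Egf.

(** * The exponential on a complex line *)

Section ComplexExponential.
Context {R : realType}.
Variables c d : R.

(** The real and imaginary parts of (c + d i) ^ k. *)
Fixpoint complex_expn k : R * R :=
  if k is k'.+1 then
    let z := complex_expn k' in (c * z.1 - d * z.2, d * z.1 + c * z.2)
  else (1, 0).

Let M := `|c| + `|d|.

Lemma complex_expn_bound k :
  `|(complex_expn k).1| <= 1 * M ^+ k /\ `|(complex_expn k).2| <= 1 * M ^+ k.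
Proof.
elim: k => [|k]; first by rewrite /= normr1 normr0 expr0 mulr1.
rewrite /= !mul1r exprS => -[h1 h2].
rewrite [M * _]mulrDl; split.
  by rewrite (le_trans (ler_normB _ _))// lerD// normrM ler_wpM2l.
by rewrite addrC (le_trans (ler_normD _ _))// lerD// normrM ler_wpM2l.
Qed.

Let re (t : R) := egf (fun k : nat => (complex_expn k).1) t.
Let im (t : R) := egf (fun k : nat => (complex_expn k).2) t.

Let dre (t : R) : is_derive t 1 re (c * re t - d * im t).
Proof.
have [b1 b2] : (forall k, `|(complex_expn k).1| <= 1 * M ^+ k) /\
               (forall k, `|(complex_expn k).2| <= 1 * M ^+ k).
  by split=> k; have [] := complex_expn_bound k.
apply: is_derive_eq (is_derive_egf t b1) _.
rewrite -mulNr -(egf_lin _ _ _ b1 b2); congr (egf _ t).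
by apply/funext => k /=; rewrite mulNr.
Qed.

Let dim (t : R) : is_derive t 1 im (d * re t + c * im t).
Proof.
have [b1 b2] : (forall k, `|(complex_expn k).1| <= 1 * M ^+ k) /\
               (forall k, `|(complex_expn k).2| <= 1 * M ^+ k).
  by split=> k; have [] := complex_expn_bound k.
by apply: is_derive_eq (is_derive_egf t b2) _; rewrite -(egf_lin _ _ _ b1 b2).
Qed.

(** As functions of t, the real and imaginary parts (re, im) of the exponential
    series at t (c + d i) solve the linear system re' = c re - d im and
    im' = d re + c im. Rotating back by the angle d t and rescaling by
    exp (- c t) gives two functions with zero derivative, hence equal to their
    values 1 and 0 at the origin. *)
Lemma egf_complex_expn :
  egf (fun k : nat => (complex_expn k).1) 1 = expR c * cos d /\
  egf (fun k : nat => (complex_expn k).2) 1 = expR c * sin d.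
Proof.
rewrite -/(re 1) -/(im 1).
have de (t : R) : is_derive t 1 (expR \o *%R (- c)) (- c * expR (- c * t)).
  exact: is_derive_mulc.
have dc (t : R) : is_derive t 1 (cos \o *%R d) (d * - sin (d * t)).
  exact: is_derive_mulc.
have ds (t : R) : is_derive t 1 (sin \o *%R d) (d * cos (d * t)).
  exact: is_derive_mulc.
have re0 : re 0 = 1 by rewrite /re egf0.
have im0 : im 0 = 0 by rewrite /im egf0.
pose h1 := (expR \o *%R (- c)) * (re * (cos \o *%R d) + im * (sin \o *%R d)).
pose h2 := (expR \o *%R (- c)) * (im * (cos \o *%R d) - re * (sin \o *%R d)).
have h1E : h1 1 = h1 0.
  apply: is_derive_0_is_cst => t.
  have := is_deriveM (de t) (is_deriveD (is_deriveM (dre t) (dc t))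
                                        (is_deriveM (dim t) (ds t))).
  move=> /is_derive_eq; apply; rewrite /GRing.scale /=.
  rewrite -[X in X * (- c * _)]/(re t * cos (d * t) + im t * sin (d * t)).
  by move: (expR _) (cos _) (sin _) (re t) (im t) => E C S X Y; ring.
have h2E : h2 1 = h2 0.
  apply: is_derive_0_is_cst => t.
  have := is_deriveM (de t) (is_deriveB (is_deriveM (dim t) (dc t))
                                        (is_deriveM (dre t) (ds t))).
  move=> /is_derive_eq; apply; rewrite /GRing.scale /=.
  rewrite -[X in X * (- c * _)]/(im t * cos (d * t) - re t * sin (d * t)).
  by move: (expR _) (cos _) (sin _) (re t) (im t) => E C S X Y; ring.
move: h1E h2E; rewrite /h1 /h2 !fctE /= !mulr0 !mulr1 re0 im0 expR0 cos0 sin0.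
rewrite !(mul0r, mulr0, mulr1, addr0, subr0) => h1E h2E.
have {}h2E : im 1 * cos d - re 1 * sin d = 0.
  by apply/eqP; move/eqP: h2E; rewrite mulf_eq0 expR_eq0.
have {}h1E : re 1 * cos d + im 1 * sin d = expR c.
  by apply: (mulfI (negbT (expR_eq0 (- c)))); rewrite h1E expRN mulVf ?expR_eq0.
have cs := cos2Dsin2 d.
rewrite -h1E; split.
  transitivity (re 1 * (cos d ^+ 2 + sin d ^+ 2)
                + sin d * (im 1 * cos d - re 1 * sin d)); last by ring.
  by rewrite cs h2E mulr1 mulr0 addr0.
transitivity (im 1 * (cos d ^+ 2 + sin d ^+ 2)
              - cos d * (im 1 * cos d - re 1 * sin d)); last by ring.
by rewrite cs h2E mulr1 mulr0 subr0.
Qed.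

End ComplexExponential.

Section ComplexLinePower.
Context {R : realType} {n : nat}.
Variable w : 'I_n -> R.
Hypothesis w1 : \sum_(i < n) w i ^+ 2 = 1.

Lemma cplxX c d k :
  cplx w c d ^+ k = cplx w (complex_expn c d k).1 (complex_expn c d k).2.
Proof.
elim: k => [|k IH]; first by rewrite expr0 -cplx_alg scale1r.
by rewrite exprS IH cplxM //=; congr cplx; ring.
Qed.

Lemma cliff_exp_cplx c d :
  cliff_exp (cplx w c d) = cplx w (expR c * cos d) (expR c * sin d).
Proof.
have [<- <-] := egf_complex_expn c d.
apply: cvg_lim; first exact: norm_hausdorff.
have [b1 b2] :
    (forall k, `|(complex_expn c d k).1| <= 1 * (`|c| + `|d|) ^+ k) /\
    (forall k, `|(complex_expn c d k).2| <= 1 * (`|c| + `|d|) ^+ k).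
  by split=> k; have [] := complex_expn_bound c d k.
rewrite [X in X @ _ --> _](_ : _ = fun k =>
    pseries (fun k => (complex_expn c d k).1 / k`!%:R) 1 k *: (1 : clifford R n)
  + pseries (fun k => (complex_expn c d k).2 / k`!%:R) 1 k *: vpart w);
  last first.
  apply/funext => k; rewrite /pseries /series /= !scaler_suml -big_split /=.
  apply: eq_bigr => i _; rewrite cplxX cplxE scalerDr !scalerA expr1n !mulr1.
  by rewrite ![_^-1 * _]mulrC.
rewrite cplxE; apply: cvgD; apply: cvgZr_tmp.
  exact: is_cvg_egf b1.
exact: is_cvg_egf b2.
Qed.

End ComplexLinePower.

(** * The principal argument on the slit plane *)

Section PrincipalArgument.
Context {R : realType}.
Implicit Types a b : R.

(** The points a + b i of the plane outside the half-line of nonpositive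
    reals. *)
Definition slit a b := (b != 0) || (0 < a).

Definition cabs a b : R := Num.sqrt (a ^+ 2 + b ^+ 2).

(** The signed argument, by the half-angle formula: unlike the arccosine of
    a / |a + b i|, it is visibly smooth across the positive real axis. *)
Definition carg a b : R := 2 * atan (b / (cabs a b + a)).

Lemma cabs_sqr a b : cabs a b ^+ 2 = a ^+ 2 + b ^+ 2.
Proof. by rewrite sqr_sqrtr// addr_ge0// sqr_ge0. Qed.

Lemma cabs_gt0 a b : slit a b -> 0 < cabs a b.
Proof.
rewrite sqrtr_gt0 => /orP[b0|a0].
  by rewrite ltr_wpDl ?sqr_ge0// exprn_even_gt0.
by rewrite ltr_pwDl ?sqr_ge0// exprn_gt0.
Qed.

(** The denominator of the half-angle formula vanishes only on the slit. *)
Lemma cabsDre_gt0 a b : slit a b -> 0 < cabs a b + a.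
Proof.
move=> ab; have r0 := cabs_gt0 ab; have rE := cabs_sqr a b.
have [a0|a0] := ltP 0 a; first by rewrite addr_gt0.
have b0 : 0 < b ^+ 2.
  by rewrite exprn_even_gt0//=; case/orP: ab => //; rewrite ltNge a0.
rewrite -ltrBlDr sub0r ltNge; apply/negP => ra.
suff : cabs a b ^+ 2 <= a ^+ 2 by rewrite rE gerDl leNgt b0.
by rewrite -[leRHS]sqrrN lerXn2r// nnegrE ?oppr_ge0 ?(ltW r0).
Qed.

(** The left-hand side is the coefficient of I in the logarithm: the arccosine
    only sees |b|, and the sign comes from the direction of the vector part. *)
Lemma acos_cabs a b : slit a b ->
  acos (a / cabs a b) * (`|b|^-1 * b) = carg a b.
Proof.
move=> ab; have r0 := cabs_gt0 ab; have ra0 := cabsDre_gt0 ab.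
have rE := cabs_sqr a b; rewrite /carg.
set r := cabs a b in r0 ra0 rE *.
set t := `|b| / (r + a).
have t0 : 0 <= t by rewrite divr_ge0// ltW.
have -> : acos (a / r) = 2 * atan t.
  have -> : a / r = cos (2 * atan t).
    rewrite mulrDl mul1r cosD -!expr2 sin2cos2 cos_atan exprVn.
    rewrite sqr_sqrtr; last first.
      by rewrite addr_ge0// sqr_ge0.
    rewrite /t expr_div_n real_normK ?num_real//.
    have -> : b ^+ 2 = (r - a) * (r + a) by rewrite -subr_sqr rE; ring.
    field; apply/and3P; split; lra.
  apply: cosK; rewrite in_itv /=; apply/andP; split.
    by rewrite mulr_ge0// -atan0 le_atan.
  by rewrite -ler_pdivlMl// mulrC ltW// atan_ltpi2.
rewrite /t; have [b0|b0|->] := ltgtP b 0.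
- rewrite ltr0_norm// (_ : (- b)^-1 * b = -1).
    by rewrite mulNr atanN mulrN1 mulrN opprK.
  by rewrite invrN mulNr mulVf ?lt_eqF.
- by rewrite gtr0_norm// mulVf ?gt_eqF// mulr1.
- by rewrite normr0 mulr0 mul0r atan0 !mulr0.
Qed.

End PrincipalArgument.

(** * Fractional powers on a complex line *)

Section PowerOnComplexLine.
Context {R : realType} {n : nat}.
Variable w : 'I_n -> R.
Hypothesis w1 : \sum_(i < n) w i ^+ 2 = 1.

Lemma nonpos_axis_cplx a b : ~ nonpos_axis (cplx w a b) <-> slit a b.
Proof.
split=> [nab|ab [c c0]].
  apply/orP; have [b0|b0] := eqVneq b 0; [right|by left].
  rewrite ltNge; apply/negP => a0; apply: nab; exists a => //.
  by rewrite (cplx_alg w) b0.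
rewrite (cplx_alg w) => /(cplx_inj w1)[ac b0].
by move: ab; rewrite /slit b0 ac eqxx ltNge c0.
Qed.

Lemma cliff_pow_cplx a b alpha : slit a b ->
  cliff_pow (cplx w a b) alpha =
  cplx w (expR (alpha * ln (cabs a b)) * cos (alpha * carg a b))
       (expR (alpha * ln (cabs a b)) * sin (alpha * carg a b)).
Proof.
move=> ab; rewrite -(cliff_exp_cplx w1); congr cliff_exp.
rewrite -cplxZ; congr (_ *: _); rewrite /cliff_log /arg /unit_im.
rewrite pnorm_vpart vnorm_vpart sc_vpart vec_vpart (sum_sqr_cplx w1) sqrtr_sqr.
by rewrite vpartZ !scalerA -mulrA -/(cabs a b) acos_cabs// cplxE.
Qed.

End PowerOnComplexLine.

(** * Differential calculus of Clifford-valued maps *)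

Section Differentials.
Context {R : realType}.
Implicit Types V W : normedModType R.

Lemma eq_is_diff V W (f g df dg : V -> W) (x : V) :
  f =1 g -> df =1 dg -> is_diff x f df -> is_diff x g dg.
Proof. by move=> /funext-> /funext->. Qed.

(** The fractional power has a closed form only off the slit, so that its
    differential is obtained from a map that agrees with it nearby. *)
Lemma near_eq_is_diff V W (f g : V -> W) (x : V) (df : V -> W) :
  (\near x, f x = g x) -> is_diff x f df -> is_diff x g df.
Proof.
move=> fg [dfx <-].
have [dfc fE] := (diff_locallyP _ _).1 dfx.
have gE : g \o shift x = cst (g x) + 'd f x +o_ 0 id.
  rewrite -(nbhs_singleton fg); apply/eqaddoP => e e0.
  have sh : \forall y \near 0, f (y + x) = g (y + x).
    by move: fg; rewrite (near_shift 0) subr0.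
  move/eqaddoP : fE => /(_ e e0); apply: filterS2 sh => y /= fgy.
  by rewrite !fctE /= fgy.
have dE := diff_unique dfc gE.
apply: DiffDef; last exact: dE.
by apply/diff_locallyP; rewrite dE.
Qed.

Lemma is_diff_coord m n (M : 'M[R]_(m, n)) i j :
  is_diff M (fun N : 'M[R]_(m, n) => N i j : R) (fun N => N i j).
Proof.
have lf : linear (fun N : 'M[R]_(m, n) => N i j) by move=> a A B; rewrite !mxE.
pose fM := GRing.isLinear.Build _ _ _ _ _ lf.
pose f : {linear 'M[R]_(m, n) -> R} :=
  HB.pack (fun N : 'M[R]_(m, n) => N i j) fM.
have fc : continuous f by exact: coord_continuous.
apply: DiffDef; first exact: differentiable_coord.
exact: (@diff_lin _ _ _ f).
Qed.

Lemma is_diff_sum V W (I : Type) (r : seq I) (f df : I -> V -> W) (x : V) :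
  (forall i, is_diff x (f i) (df i)) ->
  is_diff x (fun y => \sum_(i <- r) f i y) (fun v => \sum_(i <- r) df i v).
Proof.
move=> fd; elim: r => [|i r IH].
  have -> : (fun v => \sum_(i <- [::]) df i v) = 0.
    by apply/funext => v; rewrite big_nil.
  have -> : (fun v => \sum_(i <- [::]) f i v) = cst 0.
    by apply/funext => v; rewrite big_nil.
  exact: is_diff_cst.
have -> : (fun v => \sum_(i <- i :: r) df i v)
        = df i + (fun v => \sum_(i <- r) df i v).
  by apply/funext => v; rewrite big_cons.
have -> : (fun v => \sum_(i <- i :: r) f i v)
        = f i + (fun v => \sum_(i <- r) f i v).
  by apply/funext => v; rewrite big_cons.
exact: is_diffD.
Qed.

Lemma is_diff_scalev V W (f df : V -> R) (c : W) (x : V) :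
  is_diff x f df -> is_diff x (fun y => f y *: c) (fun v => df v *: c).
Proof. by move=> fd; exact: (is_diff_comp fd (is_diff_scalel (f x) c)). Qed.

Lemma is_diff_derive1 V (f df : V -> R) (g : R -> R) (g' : R) (x : V) :
  is_diff x f df -> is_derive (f x) 1 g g' ->
  is_diff x (fun y => g (f y)) (fun v => df v * g').
Proof.
move=> fd [gd gE].
have gdiff : differentiable g (f x) by exact/derivable1_diffP.
have : is_diff (f x) g (fun h => h * g').
  by apply: DiffDef => //; rewrite diff1E// derive1E gE.
exact: is_diff_comp.
Qed.

Lemma is_diff_mul V (f g df dg : V -> R) (x : V) :
  is_diff x f df -> is_diff x g dg ->
  is_diff x (fun y => f y * g y) (fun v => f x * dg v + g x * df v).
Proof. by move=> fd gd; exact: (is_diffM fd gd). Qed.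

Lemma is_diff_partial n (f df : 'rV[R]_n.+1 -> clifford R n) x i :
  is_diff x f df -> partial i f x = df (delta_mx ord0 i).
Proof. by move=> [fd fE]; rewrite /partial deriveE// fE. Qed.

End Differentials.

Section Leibniz.
Context {R : realType} {n : nat} {V : normedModType R}.
Implicit Types f g df dg : V -> clifford R n.

Lemma blade_expansion (q : clifford R n) :
  q = \sum_(A : {set 'I_n}) ccoef q A *: blade A.
Proof.
apply: ccoefP => B; rewrite ccoef_sum (bigD1 B)//= big1 => [|A AB].
  by rewrite ccoefZ ccoefE eqxx mulr1 addr0.
by rewrite ccoefZ ccoefE eq_sym (negPf AB) mulr0.
Qed.

Lemma cliff_mul_expansion (p q : clifford R n) :
  p * q = \sum_(A : {set 'I_n}) \sum_(B : {set 'I_n})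
            (ccoef p A * ccoef q B) *: (blade A * blade B).
Proof.
rewrite {1}(blade_expansion p) {1}(blade_expansion q) mulr_suml.
apply: eq_bigr => A _; rewrite mulr_sumr; apply: eq_bigr => B _.
by rewrite -scalerAl -scalerAr scalerA.
Qed.

(** The Leibniz rule without commutativity: the product is a finite
    combination of products of real coordinates, with constant Clifford
    coefficients. *)
Lemma is_diff_cliff_mul f g df dg x : is_diff x f df -> is_diff x g dg ->
  is_diff x (fun y => f y * g y) (fun v => f x * dg v + df v * g x).
Proof.
move=> fd gd.
have cd (h dh : V -> clifford R n) A : is_diff x h dh ->
    is_diff x (fun y => ccoef (h y) A) (fun v => ccoef (dh v) A).
  by move=> hd; exact: (is_diff_comp hd (is_diff_coord _ _ _)).
have -> : (fun v => f x * dg v + df v * g x) = fun v =>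
    \sum_(A : {set 'I_n}) \sum_(B : {set 'I_n})
      (ccoef (f x) A * ccoef (dg v) B + ccoef (g x) B * ccoef (df v) A)
        *: (blade A * blade B).
  apply/funext => v; rewrite !cliff_mul_expansion -big_split.
  apply: eq_bigr => A _; rewrite -big_split; apply: eq_bigr => B _ /=.
  by rewrite scalerDl [ccoef (df v) A * _]mulrC.
have -> : (fun y => f y * g y) = fun y =>
    \sum_(A : {set 'I_n}) \sum_(B : {set 'I_n})
      (ccoef (f y) A * ccoef (g y) B) *: (blade A * blade B).
  by apply/funext => y; rewrite cliff_mul_expansion.
apply: is_diff_sum => A; apply: is_diff_sum => B.
by apply: is_diff_scalev; apply: is_diff_mul; exact: cd.
Qed.

End Leibniz.

(** * The power rule *)

Section PowerRule.
Context {R : realType} {V : normedModType R}.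
Variables (a b da db : V -> R) (x : V).
Hypotheses (ad : is_diff x a da) (bd : is_diff x b db).
Hypothesis abx : slit (a x) (b x).

Let r := cabs (a x) (b x).

Lemma is_diff_cabs : is_diff x (fun y => cabs (a y) (b y))
  (fun v => (a x * da v + b x * db v) / r).
Proof.
have r0 := cabs_gt0 abx.
have sd := is_diffD (is_diff_mul ad ad) (is_diff_mul bd bd).
have s0 : 0 < a x * a x + b x * b x.
  by have := exprn_gt0 2 r0; rewrite cabs_sqr.
apply: is_diff_eq (is_diff_derive1 sd (is_derive1_sqrt s0)) _.
apply/funext => v; rewrite !fctE -/(cabs (a x) (b x)) -/r.
by rewrite -/r in r0; field; rewrite gt_eqF.
Qed.

(** With [is_diff_carg], this says that d log z = conj z dz / |z| ^ 2 for
    z = a + b i. *)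
Lemma is_diff_ln_cabs : is_diff x (fun y => ln (cabs (a y) (b y)))
  (fun v => (a x * da v + b x * db v) / r ^+ 2).
Proof.
apply: is_diff_eq
  (is_diff_derive1 is_diff_cabs (is_derive1_ln (cabs_gt0 abx))) _.
by apply/funext => v; rewrite -/r expr2 invfM mulrA.
Qed.

Lemma is_diff_carg : is_diff x (fun y => carg (a y) (b y))
  (fun v => (a x * db v - b x * da v) / r ^+ 2).
Proof.
have r0 : 0 < r := cabs_gt0 abx.
have ra0 : 0 < r + a x := cabsDre_gt0 abx.
have rE : r ^+ 2 = a x ^+ 2 + b x ^+ 2 := cabs_sqr _ _.
have invd : is_derive (r + a x) 1 GRing.inv (- (r + a x) ^- 2).
  have := @is_deriveV _ id _ 1 1 (lt0r_neq0 ra0) (is_derive_id _ _).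
  by move=> /is_derive_eq; apply; rewrite /GRing.scale /= mulr1.
have td := is_diff_mul bd (is_diff_derive1 (is_diffD is_diff_cabs ad) invd).
apply: is_diff_eq (is_diffZ 2 (is_diff_derive1 td (is_derive1_atan _))) _.
apply/funext => v; rewrite !fctE /GRing.scale /= -/r.
have -> : 1 + (b x * (r + a x)^-1) ^+ 2 = 2 * r / (r + a x).
  rewrite expr_div_n (_ : b x ^+ 2 = (r - a x) * (r + a x)).
    by field; rewrite gt_eqF.
  by rewrite -subr_sqr rE; ring.
(* both sides differ by a multiple of r ^ 2 - (a ^ 2 + b ^ 2) *)
have num : r * (r + a x) * db v - b x * (a x * da v + b x * db v + r * da v)
    = (r + a x) * (a x * db v - b x * da v).
  apply/eqP; rewrite -subr_eq0; apply/eqP.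
  transitivity ((r ^+ 2 - (a x ^+ 2 + b x ^+ 2)) * db v); first by ring.
  by rewrite rE subrr mul0r.
transitivity ((r * (r + a x) * db v
    - b x * (a x * da v + b x * db v + r * da v)) / ((r + a x) * r ^+ 2)).
  by field; rewrite !gt_eqF.
by rewrite num; field; rewrite !gt_eqF.
Qed.

Context {n : nat} (w : 'I_n -> R).
Hypothesis w1 : \sum_(i < n) w i ^+ 2 = 1.

Lemma is_diff_cplx (p q dp dq : V -> R) : is_diff x p dp -> is_diff x q dq ->
  is_diff x (fun y => cplx w (p y) (q y)) (fun v => cplx w (dp v) (dq v)).
Proof.
move=> pd qd.
have := is_diffD (is_diff_scalev (1 : clifford R n) pd)
                 (is_diff_scalev (vpart w) qd).
rewrite (_ : (fun y => cplx w (p y) (q y)) =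
    (fun y => p y *: (1 : clifford R n)) + (fun y => q y *: vpart w));
  last first.
  by apply/funext => y; rewrite cplxE.
by move=> /is_diff_eq; apply; apply/funext => v; rewrite cplxE.
Qed.

(** The inverse of p + q I. *)
Definition cinv (p q : R) : clifford R n :=
  cplx w (p / cabs p q ^+ 2) (- q / cabs p q ^+ 2).

Lemma mul_cinv p q : slit p q -> cplx w p q * cinv p q = 1.
Proof.
move=> /cabs_gt0; rewrite /cinv (cplxM w1) -[1]scale1r (cplx_alg w) => c0.
congr cplx; last by ring.
rewrite -[RHS](@divff _ (cabs p q ^+ 2)) ?gt_eqF ?exprn_gt0//.
by rewrite [in X in _ = X / _]cabs_sqr; ring.
Qed.

(** d z ^ alpha = alpha dz z ^ -1 z ^ alpha; all the factors lie in one complex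
    line, which is what makes the usual formula valid. *)
Lemma is_diff_cliff_pow (alpha : R) : (\near x, slit (a x) (b x)) ->
  is_diff x (fun y => cliff_pow (cplx w (a y) (b y)) alpha)
    (fun v => alpha *: (cplx w (da v) (db v) *
       (cinv (a x) (b x) * cliff_pow (cplx w (a x) (b x)) alpha))).
Proof.
move=> near_slit.
have ld := is_diffZ alpha is_diff_ln_cabs.
have td := is_diffZ alpha is_diff_carg.
have ed := is_diff_derive1 ld (is_derive_expR _).
have cd := is_diff_derive1 td (is_derive_cos _).
have sd := is_diff_derive1 td (is_derive_sin _).
have powE : \forall y \near x,
    cplx w (expR (alpha * ln (cabs (a y) (b y))) *
              cos (alpha * carg (a y) (b y)))
           (expR (alpha * ln (cabs (a y) (b y))) *
              sin (alpha * carg (a y) (b y)))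
    = cliff_pow (cplx w (a y) (b y)) alpha.
  by apply: filterS near_slit => y aby; rewrite (cliff_pow_cplx w1).
apply: is_diff_eq (near_eq_is_diff powE
  (is_diff_cplx (is_diff_mul ed cd) (is_diff_mul ed sd))) _.
apply/funext => v; rewrite (cliff_pow_cplx w1)// /cinv !(cplxM w1) cplxZ.
by congr cplx; rewrite -/r !fctE /GRing.scale /=; ring.
Qed.

End PowerRule.

(** * The Cauchy-Riemann operator on the kernels *)

Section KernelDirac.
Context {R : realType} {n : nat}.
Variables (s : 'rV[R]_n.+1) (v : R) (w : 'I_n -> R).
Hypotheses (w1 : \sum_(i < n) w i ^+ 2 = 1) (sE : xvec s = fun i => v * w i).
Implicit Types x : 'rV[R]_n.+1.
Let u : R := s ord0 ord0.

Lemma para_cplx : para s = cplx w u v.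
Proof. by rewrite paraE sE. Qed.

(** [base_re] and [base_im] are the coordinates of s ^ 2 - 2 x_0 s + |x| ^ 2 on
    the complex line through s = u + v I, which does not depend on x. *)
Definition base_re x : R :=
  u ^+ 2 - v ^+ 2 - 2 * u * x ord0 ord0
  + (x ord0 ord0 ^+ 2 + \sum_(i < n) xvec x i ^+ 2).

Definition base_im x : R := 2 * v * (u - x ord0 ord0).

Lemma kernel_base_cplx x : kernel_base s x = cplx w (base_re x) (base_im x).
Proof.
rewrite /kernel_base para_cplx paraE sc_vpart pnorm_vpart_sqr.
rewrite expr2 (cplxM w1) cplxZ (cplx_alg w) cplxN !cplxD.
by congr cplx; rewrite /base_re /base_im; ring.
Qed.

(** The base vanishes on the sphere of s, so that avoiding the slit already
    excludes this sphere. *)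
Lemma kernel_domE : kernel_dom s = [set x | slit (base_re x) (base_im x)].
Proof.
apply/seteqP; split=> x /=; rewrite /kernel_dom /= kernel_base_cplx.
  by move=> [_ [_]]; rewrite (nonpos_axis_cplx w1).
move=> ab; split; last first.
  by split; [exact: paravector_vpart | exact/(nonpos_axis_cplx w1)].
move=> [_ [z z1 ->]].
rewrite para_cplx sc_vpart vnorm_vpart (sum_sqr_cplx w1).
rewrite sqrtr_sqr -/(vpart (fun i => z ord0 i)) -vpartZ => xE.
have x0 : x ord0 ord0 = u by have := congr1 sc xE; rewrite paraE !sc_vpart.
have xv i : xvec x i = `|v| * z ord0 i.
  have := congr1 (fun q => ccoef q [set i]%SET) xE.
  by rewrite paraE !ccoef1_vpart.
have xx : \sum_(i < n) xvec x i ^+ 2 = v ^+ 2.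
  under eq_bigr do rewrite xv exprMn real_normK ?num_real//.
  by rewrite -mulr_sumr z1 mulr1.
move: ab; rewrite /slit /base_im x0 subrr mulr0 eqxx /= /base_re xx x0.
by rewrite (_ : _ + _ = 0) ?ltxx//; ring.
Qed.

(** At a real point x_0 = u + 1 the base is 1 - v ^ 2 - 2 v I, which is
    nonreal unless v = 0, and then equal to 1. *)
Lemma kernel_dom_neq0 : exists x, kernel_dom s x.
Proof.
exists ((u + 1) *: delta_mx ord0 ord0); rewrite kernel_domE /= /slit.
rewrite /base_im /base_re !mxE !eqxx /= mulr1 big1 => [|i _]; last first.
  by rewrite /xvec !mxE eqxx /= mulr0 expr0n.
have [v0|v0] := eqVneq v 0; last first.
  by rewrite opprD addNKr mulrN1 oppr_eq0 mulf_neq0// pnatr_eq0.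
by rewrite v0; apply/orP; right; rewrite [ltRHS](_ : _ = 1)//; ring.
Qed.

Lemma is_diff_base_re x : is_diff x base_re (fun h =>
  2 * (x ord0 ord0 - u) * h ord0 ord0 + \sum_(i < n) 2 * xvec x i * xvec h i).
Proof.
have c0 : is_diff x (cst (u ^+ 2 - v ^+ 2)) (fun=> 0) by exact: is_diff_cst.
have cd j := is_diff_coord x ord0 j.
have sd := is_diff_sum (index_enum 'I_n)
  (fun i => is_diff_mul (cd (lift ord0 i)) (cd (lift ord0 i))).
have := is_diffD (is_diffB c0
  (is_diffZ (2 * u) (cd ord0))) (is_diffD (is_diff_mul (cd ord0) (cd ord0)) sd).
move=> /is_diff_eq; apply; apply/funext => h.
rewrite !fctE /GRing.scale /= addrA; congr (_ + _); first by ring.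
by apply: eq_bigr => i _; rewrite /xvec; ring.
Qed.

Lemma is_diff_base_im x :
  is_diff x base_im (fun h => - (2 * v) * h ord0 ord0).
Proof.
have c0 : is_diff x (cst u) (fun=> 0) by exact: is_diff_cst.
have := is_diffZ (2 * v) (is_diffB c0 (is_diff_coord x ord0 ord0)).
move=> /is_diff_eq; apply; apply/funext => h.
by rewrite !fctE /GRing.scale /=; ring.
Qed.

Lemma open_kernel_dom : open (kernel_dom s).
Proof.
rewrite kernel_domE.
rewrite (_ : [set x | _] = base_im @^-1` [set y | y != 0]
                       `|` base_re @^-1` [set y | 0 < y]); last first.
  by apply/seteqP; split=> x /=; rewrite /slit => /orP.
apply: openU; apply: open_comp.
- by move=> x _; apply: differentiable_continuous; have [] := is_diff_base_im x.
- exact: open_neq.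
- by move=> x _; apply: differentiable_continuous; have [] := is_diff_base_re x.
- exact: open_gt.
Qed.

Lemma is_diff_factor x : is_diff x (fun y => para s - pconj (para y))
  (fun h => vpart (xvec h) - (h ord0 ord0)%:A).
Proof.
have cd j := is_diff_coord x ord0 j.
have sd := is_diff_sum (index_enum 'I_n)
  (fun i => is_diff_scalev (gen i : clifford R n) (cd (lift ord0 i))).
have sc0 : is_diff x (cst (para s)) (fun=> 0) by exact: is_diff_cst.
have := is_diffB sc0
  (is_diffB (is_diff_scalev (1 : clifford R n) (cd ord0)) sd).
apply: eq_is_diff => [y|h]; first by rewrite paraE pconj_vpart.
by rewrite !fctE sub0r opprB.
Qed.

Lemma vpart_delta0 : vpart (xvec (delta_mx ord0 ord0)) = 0 :> clifford R n.
Proof. by rewrite /vpart big1// => i _; rewrite /xvec mxE /= scale0r. Qed.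

Lemma vpart_delta i :
  vpart (xvec (delta_mx ord0 (lift ord0 i))) = gen i :> clifford R n.
Proof.
rewrite /vpart (bigD1 i)//= big1 => [|j ji]; last first.
  by rewrite /xvec mxE /= (inj_eq lift_inj) (negPf ji) scale0r.
by rewrite /xvec mxE !eqxx /= scale1r addr0.
Qed.

Section AtPoint.
Variables (lambda : R) (x : 'rV[R]_n.+1).
Hypothesis xs : kernel_dom s x.
Let N := para s - pconj (para x).
Let P := kernel_base s x.
Let pow := cliff_pow P (- lambda).
(* P ^ -1 P ^ - lambda, by which the derivatives of P get multiplied *)
Let Q := cinv w (base_re x) (base_im x) * pow.
Let dP (h : 'rV[R]_n.+1) : clifford R n :=
  cplx w (2 * (x ord0 ord0 - u) * h ord0 ord0
        + \sum_(i < n) 2 * xvec x i * xvec h i) (- (2 * v) * h ord0 ord0).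

Let slit_x : slit (base_re x) (base_im x).
Proof. by move: xs; rewrite kernel_domE. Qed.

Let is_diff_pow : is_diff x (fun y => cliff_pow (kernel_base s y) (- lambda))
  (fun h => - lambda *: (dP h * Q)).
Proof.
have near_slit : \forall y \near x, slit (base_re y) (base_im y).
  have : \forall y \near x, kernel_dom s y.
    by apply: open_nbhs_nbhs; split => //; exact: open_kernel_dom.
  by rewrite kernel_domE.
have := is_diff_cliff_pow (is_diff_base_re x) (is_diff_base_im x) slit_x w1
  (- lambda) near_slit.
apply: eq_is_diff => [y|h]; first by rewrite kernel_base_cplx.
by rewrite /Q /pow /P kernel_base_cplx.
Qed.

Let powE : {p : R * R | pow = cplx w p.1 p.2 & pow != 0}.
Proof.
rewrite /pow /P kernel_base_cplx (cliff_pow_cplx w1)//.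
eexists (_, _); first by [].
apply/eqP; rewrite -(scale0r (1 : clifford R n)) (cplx_alg w).
move=> /(cplx_inj w1)[/eqP + /eqP]; rewrite !mulf_eq0 !expR_eq0 /=.
move=> /eqP c0 /eqP s0.
have := cos2Dsin2 (- lambda * carg (base_re x) (base_im x)).
by rewrite c0 s0 expr0n addr0 => /esym/eqP; rewrite oner_eq0.
Qed.

Let mul_PQ : P * Q = pow.
Proof. by rewrite /Q mulrA /P kernel_base_cplx (mul_cinv w1)// mul1r. Qed.

Let dP0 : dP (delta_mx ord0 ord0) = 2 *: ((x ord0 ord0)%:A - para s).
Proof.
rewrite para_cplx (cplx_alg w) cplxN cplxD cplxZ /dP mxE /= big1 => [|i _].
  by congr cplx; ring.
by rewrite /xvec mxE /= mulr0.
Qed.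

Let dPi i : dP (delta_mx ord0 (lift ord0 i)) = (2 * xvec x i)%:A.
Proof.
rewrite (cplx_alg w) /dP mxE /= !mulr0 add0r (bigD1 i)//= big1 => [|j ji].
  by congr cplx; rewrite /xvec mxE !eqxx mulr1 addr0.
by rewrite /xvec mxE /= (inj_eq lift_inj) (negPf ji) mulr0.
Qed.

Let dP_comm h : dP h * Q = Q * dP h.
Proof.
rewrite /Q; have [p -> _] := powE.
by rewrite /cinv (cplxM w1) (cplxMC w1).
Qed.

Let X0 : clifford R n := (x ord0 ord0)%:A.
Let X := vpart (xvec x) : clifford R n.

Let NE : N = para s - X0 + X.
Proof. by rewrite /N paraE pconj_vpart opprB addrA addrAC. Qed.

Let PE : P = para s ^+ 2 - (2 * x ord0 ord0) *: para s + X0 ^+ 2 - X ^+ 2.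
Proof.
rewrite /P /kernel_base [para x]paraE sc_vpart pnorm_vpart_sqr.
rewrite scalerDl addrA; congr (_ + _ + _).
  by rewrite [in RHS]expr2 /X0 -scalerAl mul1r scalerA -expr2.
by rewrite expr2 vpart_sqr opprK.
Qed.

Lemma is_diff_kL : is_diff x (kL lambda s)
  (fun h => N * (- lambda *: (dP h * Q))
            + (vpart (xvec h) - (h ord0 ord0)%:A) * pow).
Proof. exact: is_diff_cliff_mul (is_diff_factor x) is_diff_pow. Qed.

Lemma is_diff_kR : is_diff x (kR lambda s)
  (fun h => pow * (vpart (xvec h) - (h ord0 ord0)%:A)
            + (- lambda *: (dP h * Q)) * N).
Proof. exact: is_diff_cliff_mul is_diff_pow (is_diff_factor x). Qed.

(** For x and s that need not commute, the derivatives of the base combine with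
    the factor s - conj x to give back the base: writing N = (s - x_0) + x_, one
    gets x_ N - N (s - x_0) = 2 x_0 s - s ^ 2 - |x| ^ 2. *)
Let factor_identities :
  X * N - N * (para s - X0) = - P /\ N * X - (para s - X0) * N = - P.
Proof.
have N0 q : q * X0 = X0 * q by rewrite /X0 -scalerAl -scalerAr mul1r mulr1.
rewrite NE PE.
have -> : (2 * x ord0 ord0) *: para s = X0 * para s + X0 * para s.
  by rewrite /X0 -scalerAl mul1r -scalerDl; congr (_ *: _); ring.
(* coordinatewise, the noncommutative monomials are atoms of a real identity *)
split; apply: ccoefP => A;
  rewrite !expr2 !(mulrDl, mulrDr, mulrN, mulNr, opprD, opprK) !N0;
  rewrite !(ccoefD, ccoefN); ring.
Qed.

(** The factor s - conj x contributes - (n + 1), namely - 1 for x_0 and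
    e_i ^ 2 = - 1 for each x_i; by [factor_identities] the power contributes
    2 lambda P (P ^ -1 P ^ - lambda). *)
Lemma dirac_kL :
  partial ord0 (kL lambda s) x
  + \sum_(i < n) gen i * partial (lift ord0 i) (kL lambda s) x
  = (2 * lambda - n.+1%:R) *: pow.
Proof.
rewrite (is_diff_partial _ is_diff_kL) vpart_delta0 sub0r dP0 mxE eqxx scale1r.
have -> : \sum_(i < n) gen i * partial (lift ord0 i) (kL lambda s) x
    = - (2 * lambda) *: (X * N * Q) - n%:R *: pow.
  rewrite -mulrA {1}/X /vpart mulr_suml scaler_sumr.
  have -> : n%:R *: pow = \sum_(i < n) pow.
    by rewrite sumr_const card_ord scaler_nat.
  rewrite -sumrB.
  apply: eq_bigr => i _.
  rewrite (is_diff_partial _ is_diff_kL) vpart_delta dPi mxE /= scale0r subr0.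
  rewrite mulrDr [_ * (gen i * pow)]mulrA gen_sqr mulN1r.
  rewrite -[_%:A * Q]scalerAl mul1r -!scalerAr scalerA -scalerAl scalerA.
  by congr (_ *: _ - _); ring.
have -> : N * (- lambda *: (2 *: (X0 - para s) * Q))
    = (2 * lambda) *: (N * (para s - X0) * Q).
  rewrite -[X0 - _]opprB -scalerAl -!scalerAr [- _ * Q]mulNr mulrN scalerN.
  by rewrite scalerN scalerA -scaleNr mulrA; congr (_ *: _); ring.
rewrite [X * N](_ : _ = N * (para s - X0) - P); last first.
  by have [<- _] := factor_identities; rewrite addrC subrK.
rewrite [(_ - P) * Q]mulrBl mul_PQ mulN1r -natr1; apply: ccoefP => A.
by rewrite !(ccoefD, ccoefN, ccoefZ); ring.
Qed.

(** The mirror image of [dirac_kL]: the derivatives of P commute with the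
    powers of P, so that they can be moved next to the factor s - conj x. *)
Lemma dirac_kR :
  partial ord0 (kR lambda s) x
  + \sum_(i < n) partial (lift ord0 i) (kR lambda s) x * gen i
  = (2 * lambda - n.+1%:R) *: pow.
Proof.
rewrite (is_diff_partial _ is_diff_kR) vpart_delta0 sub0r dP_comm.
rewrite dP0 mxE eqxx scale1r.
have -> : \sum_(i < n) partial (lift ord0 i) (kR lambda s) x * gen i
    = - (2 * lambda) *: (Q * (N * X)) - n%:R *: pow.
  rewrite mulrA {1}/X /vpart mulr_sumr scaler_sumr.
  have -> : n%:R *: pow = \sum_(i < n) pow.
    by rewrite sumr_const card_ord scaler_nat.
  rewrite -sumrB.
  apply: eq_bigr => i _.
  rewrite (is_diff_partial _ is_diff_kR) vpart_delta dP_comm dPi mxE /=.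
  rewrite scale0r subr0 mulrDl -[pow * _ * _]mulrA gen_sqr mulrN1 addrC.
  rewrite -[Q * _%:A]scalerAr mulr1 -!scalerAl -!scalerAr !scalerA.
  by congr (_ *: _ - _); ring.
have -> : (- lambda *: (Q * (2 *: (X0 - para s)))) * N
    = (2 * lambda) *: (Q * ((para s - X0) * N)).
  rewrite -[X0 - _]opprB -!scalerAr -!scalerAl mulrN mulNr scalerN.
  by rewrite scalerN scalerA -scaleNr mulrA; congr (_ *: _); ring.
rewrite [N * X](_ : _ = (para s - X0) * N - P); last first.
  by have [_ <-] := factor_identities; rewrite addrC subrK.
have QP : Q * P = pow.
  rewrite -mul_PQ /P kernel_base_cplx /Q; have [p -> _] := powE.
  by rewrite /cinv (cplxM w1) (cplxMC w1).
rewrite [Q * (_ - P)]mulrBr QP mulrN1 -natr1; apply: ccoefP => A.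
by rewrite !(ccoefD, ccoefN, ccoefZ); ring.
Qed.

Lemma cliff_pow_neq0 : pow != 0.
Proof. by have [] := powE. Qed.

End AtPoint.
End KernelDirac.

(** The direction of s_ is a unit vector of the required kind; when s_ = 0, any
    unit vector will do, and there is one because n is positive. *)
Lemma xvec_polar {R : realType} {n : nat} (s : 'rV[R]_n.+1) : (1 <= n)%N ->
  exists v, exists2 w : 'I_n -> R,
    \sum_(i < n) w i ^+ 2 = 1 & xvec s = fun i => v * w i.
Proof.
move=> n1; set V := \sum_(i < n) xvec s i ^+ 2.
have V0 : 0 <= V by apply: sumr_ge0 => i _; rewrite sqr_ge0.
have [VE|VN] := eqVneq V 0.
  exists 0, (fun i => (i == Ordinal n1)%:R).
    rewrite (bigD1 (Ordinal n1))//= ?eqxx expr1n big1 ?addr0// => i /negPf->.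
    by rewrite expr0n.
  apply/funext => i; rewrite mul0r; apply/eqP; rewrite -sqrf_eq0; apply/eqP.
  have := psumr_eq0P (fun i _ => sqr_ge0 (xvec s i)) VE.
  exact.
have rV : Num.sqrt V != 0 by rewrite sqrtr_eq0 -ltNge lt_def VN.
exists (Num.sqrt V), (fun i => xvec s i / Num.sqrt V).
  under eq_bigr do rewrite expr_div_n sqr_sqrtr//.
  by rewrite -mulr_suml divff.
by apply/funext => i; rewrite mulrC divfK.
Qed.

Theorem theorem2p15 (R : realType) (n : nat) (n_ge1 : (1 <= n)%N)
    (lambda : R) (s : 'rV[R]_n.+1) :
  (left_monogenic (kernel_dom s) (kL lambda s) <-> lambda = n.+1%:R / 2) /\
  (right_monogenic (kernel_dom s) (kR lambda s) <-> lambda = n.+1%:R / 2).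
Proof.
have [v [w w1 sE]] := xvec_polar s n_ge1.
have [x0 x0s] := kernel_dom_neq0 w1 sE.
have lambdaE (q : clifford R n) : q != 0 ->
    (2 * lambda - n.+1%:R) *: q = 0 -> lambda = n.+1%:R / 2.
  move=> q0 /eqP; rewrite scaler_eq0 (negPf q0) orbF subr_eq0 => /eqP <-.
  by rewrite mulrC mulKf// pnatr_eq0.
have lambda0 : lambda = n.+1%:R / 2 -> 2 * lambda - n.+1%:R = 0.
  by move=> ->; rewrite mulrC divfK ?subrr// pnatr_eq0.
split; split.
- move=> [_ /(_ _ x0s)[_]]; rewrite (dirac_kL w1 sE)//.
  exact/lambdaE/(cliff_pow_neq0 w1 sE).
- move=> /lambda0 l0; split; first exact: (open_kernel_dom w1 sE).
  move=> x xs; rewrite (dirac_kL w1 sE)// l0 scale0r; split=> //.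
  by have [] := is_diff_kL w1 sE lambda xs.
- move=> [_ /(_ _ x0s)[_]]; rewrite (dirac_kR w1 sE)//.
  exact/lambdaE/(cliff_pow_neq0 w1 sE).
- move=> /lambda0 l0; split; first exact: (open_kernel_dom w1 sE).
  move=> x xs; rewrite (dirac_kR w1 sE)// l0 scale0r; split=> //.
  by have [] := is_diff_kR w1 sE lambda xs.
Qed.
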